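(* Let $K$ be a field, $S=K[x_1,\ldots,x_n]$, let $I\subset S$ be a homogeneous ideal and let $\{f_1,\ldots,f_m\}$ be a minimal system of homogeneous generators for $I$. If $I$ has linear quotients with respect to $f_1,\ldots,f_m$ (in this order), then $I$ is a componentwise linear ideal.
   Context: $S=K[x_1,\ldots,x_n]$ is the polynomial ring over a field $K$ with its standard grading. If $\{f_1,\ldots,f_m\}$ is a system of homogeneous generators of a homogeneous ideal $I\subset S$, then $I$ has linear quotients with respect to the elements $f_1,\ldots,f_m$ if the ideal $\langle f_1,\ldots,f_{i-1}\rangle : f_i$ is generated by linear forms for all $i=2,\ldots,m$ (this property depends on the order of the generators; no assumption is made that the degrees $\deg(f_i)$ are increasing). For a graded ideal $J\subset S$, $J_{\langle j\rangle}$ denotes the ideal generated by all homogeneous polynomials of degree $j$ belonging to $J$. $J$ is componentwise linear if $J_{\langle j\rangle}$ has a $j$-linear resolution for all $j$. A graded $S$-module $M$ has a $j$-linear resolution if $\operatorname{Tor}_i^S(K,M)_{i+k}=0$ for all $i$ and all $k\neq j$ (the zero module is regarded as having a $j$-linear resolution). *)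

(* Defs.v *)
From mathcomp Require Import all_boot all_order all_algebra.
From mathcomp Require Export mpoly.

Set Implicit Arguments.
Unset Strict Implicit.
Unset Printing Implicit Defensive.

Import GRing.Theory.
Local Open Scope ring_scope.

(* Subsets of S = {mpoly K[n]}, in particular ideals, are predicates
   {mpoly K[n]} -> Prop, compared up to pointwise equivalence. *)
Section Ideals.
Variables (K : fieldType) (n : nat).
Local Notation S := {mpoly K[n]}.

Definition same_ideal (I J : S -> Prop) : Prop := forall p, I p <-> J p.

Definition is_ideal (I : S -> Prop) : Prop :=
  [/\ I 0, (forall p q, I p -> I q -> I (p + q))
         & (forall a p, I p -> I (a * p))].

Definition homogeneous_ideal (I : S -> Prop) : Prop :=
  is_ideal I /\ forall p d, I p -> I (pihomog mdeg d p).

Definition ideal_gen (G : S -> Prop) : S -> Prop := fun p =>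
  exists s : seq (S * S),
    (forall u, u \in s -> G u.2) /\ p = \sum_(u <- s) u.1 * u.2.

Definition colon (J : S -> Prop) (g : S) : S -> Prop := fun p => J (p * g).

Definition generated_by_linear_forms (J : S -> Prop) : Prop :=
  exists L : S -> Prop,
    (forall l, L l -> l \is 1.-homog) /\ same_ideal J (ideal_gen L).

(* J_<j> *)
Definition ideal_component (j : nat) (J : S -> Prop) : S -> Prop :=
  ideal_gen (fun p => J p /\ p \is j.-homog).

Section Generators.
Variables (m : nat) (f : 'I_m -> S).

Definition subfamily (P : pred 'I_m) : S -> Prop :=
  fun p => exists2 k, P k & p = f k.

Definition homogeneous_generators (I : S -> Prop) : Prop :=
  (forall k, f k \is homog mdeg) /\ same_ideal I (ideal_gen (subfamily predT)).

(* Applied to subfamilies of indices, this also forces the f k to be pairwise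
   distinct. *)
Definition minimal_homogeneous_generators (I : S -> Prop) : Prop :=
  homogeneous_generators I /\
  forall A : {set 'I_m},
    same_ideal I (ideal_gen (subfamily (mem A))) -> A = [set: 'I_m].

(* Indices start at 0, so "i = 2, ..., m" reads 0 < i < m. *)
Definition linear_quotients (I : S -> Prop) : Prop :=
  homogeneous_generators I /\
  forall i : 'I_m, (0 < i)%N ->
    generated_by_linear_forms
      (colon (ideal_gen (subfamily (fun k : 'I_m => (k < i)%N))) (f i)).

End Generators.
End Ideals.

Section Tor.
Variables (K : fieldType) (n : nat).
Local Notation S := {mpoly K[n]}.

(* p lies in the degree d component of the shifted module S(-e). *)
Definition shifted_homog (d e : nat) (p : S) : Prop :=
  if (e <= d)%N then p \is (d - e)%N.-homog else p == 0.

(* The map S -> S / (x_1, ..., x_n) = K. *)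
Definition residue_mx (a b : nat) (A : 'M[S]_(a, b)) : 'M[K]_(a, b) :=
  map_mx (mcoeff 0%MM) A.

(* A graded free resolution  ... -> P_1 -> P_0 -> K -> 0  over S, where
   P_i = \bigoplus_(a < res_rank i) S(- res_shift a); elements are row vectors
   and maps act by right multiplication. *)
Record graded_free_resolution_of_K := GradedFreeResolution {
  res_rank : nat -> nat;
  res_shift : forall i, 'I_(res_rank i) -> nat;
  res_diff : forall i, 'M[S]_(res_rank i.+1, res_rank i);
  res_aug : 'cV[K]_(res_rank 0);
  res_diff_homog : forall i (a : 'I_(res_rank i.+1)) (b : 'I_(res_rank i)),
    shifted_homog (res_shift a) (res_shift b) (res_diff i a b);
  res_aug_homog : forall a, res_aug a 0 != 0 -> res_shift a = 0%N;
  res_aug_onto : forall c : 'M[K]_1,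
    exists v : 'rV[S]_(res_rank 0), residue_mx v *m res_aug = c;
  res_exact_aug : forall v : 'rV[S]_(res_rank 0),
    residue_mx v *m res_aug = 0 <->
    exists w : 'rV[S]_(res_rank 1), v = w *m res_diff 0;
  res_exact : forall i (v : 'rV[S]_(res_rank i.+1)),
    v *m res_diff i = 0 <->
    exists w : 'rV[S]_(res_rank i.+2), v = w *m res_diff i.+1
}.

Variable M : S -> Prop.

(* The degree d component of P_i (x)_S M = \bigoplus_a M(- res_shift a),
   for an ideal M. *)
Definition tensor_chain (P : graded_free_resolution_of_K) (i d : nat)
    (v : 'rV[S]_(res_rank P i)) : Prop :=
  forall a, M (v 0 a) /\ shifted_homog d (res_shift a) (v 0 a).

Definition tensor_cycle (P : graded_free_resolution_of_K) (i : nat) :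
    'rV[S]_(res_rank P i) -> Prop :=
  match i with
  | 0 => fun _ => True
  | i'.+1 => fun v => v *m res_diff P i' = 0
  end.

(* H_i(P (x)_S M)_d = 0. *)
Definition tensor_homology_vanishes (P : graded_free_resolution_of_K)
    (i d : nat) : Prop :=
  forall v : 'rV[S]_(res_rank P i), tensor_chain d v -> tensor_cycle v ->
  exists2 w : 'rV[S]_(res_rank P i.+1),
    tensor_chain d w & v = w *m res_diff P i.

(* Tor_i^S(K, M)_d = 0 for an ideal M. Tor is the homology of P (x)_S M for a
   graded free resolution P of K; it does not depend on P, and requiring that
   some P exists keeps the condition from being vacuous. *)
Definition Tor_vanishes (i d : nat) : Prop :=
  exists P : graded_free_resolution_of_K, tensor_homology_vanishes P i d.

(* d stands for i + k, so that k != j reads d != i + j; k may be negative.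
   Degrees d < 0 are omitted: there P (x)_S M is zero. *)
Definition linear_resolution (j : nat) : Prop :=
  forall i d : nat, d != (i + j)%N -> Tor_vanishes i d.

End Tor.

Definition componentwise_linear (K : fieldType) (n : nat)
    (J : {mpoly K[n]} -> Prop) : Prop :=
  forall j : nat, linear_resolution (ideal_component j J) j.

(* Main.v *)
Require Import Defs.
From mathcomp Require Import all_boot all_order all_algebra.

(* Tor is computed with the Koszul complex on x_1, ..., x_n. In homological
   degree i and total degree d only the components of I_<j> in degrees d - i - 1
   and d - i matter: below degree j they are zero, and from degree j on they
   agree with those of the ideal J generated by the f_k with deg f_k <= j. So
   it suffices that the Koszul homology of J vanishes in coefficient degrees
   above j. By minimality the f_k with deg f_k <= j again have linear
   quotients, hence J is filtered with successive quotients S/L(-deg f_k),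
   where L is generated by linear forms, and the Koszul homology of S/L is
   concentrated in coefficient degree 0. The latter follows from the case
   L = 0 by adding one linear form at a time, since ideals generated by linear
   forms are prime. *)

Set Implicit Arguments.
Unset Strict Implicit.
Unset Printing Implicit Defensive.

Import GRing.Theory.
Local Open Scope ring_scope.

(** * Ideals and homogeneous components *)

Section Ideals.
Variables (K : fieldType) (n : nat).
Local Notation S := {mpoly K[n]}.
Implicit Types (J G : S -> Prop) (p q l : S).

Lemma ideal_gen_is_ideal G : is_ideal (ideal_gen G).
Proof.
split=> [|p q [s [sG ->]] [t [tG ->]]|a p [s [sG ->]]].
- by exists [::]; rewrite big_nil.
- exists (s ++ t); rewrite big_cat; split=> // u.
  by rewrite mem_cat => /orP[/sG | /tG].
- exists [seq (a * u.1, u.2) | u <- s]; split=> [u /mapP[v /sG Gv ->] //|].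
  by rewrite big_map mulr_sumr; apply: eq_bigr => u _; rewrite mulrA.
Qed.

Lemma ideal_gen_mem G p : G p -> ideal_gen G p.
Proof.
move=> Gp; exists [:: (1, p)]; rewrite big_seq1 mul1r.
by split=> // u; rewrite inE => /eqP ->.
Qed.

Lemma ideal0 J : is_ideal J -> J 0. Proof. by case. Qed.

Lemma idealD J p q : is_ideal J -> J p -> J q -> J (p + q).
Proof. by case=> _ JD _; apply: JD. Qed.

Lemma idealM J a p : is_ideal J -> J p -> J (a * p).
Proof. by case=> _ _; apply. Qed.

Lemma idealN J p : is_ideal J -> J p -> J (- p).
Proof. by move=> idJ Jp; rewrite -mulN1r; apply: idealM. Qed.

Lemma idealB J p q : is_ideal J -> J p -> J q -> J (p - q).
Proof. by move=> idJ Jp Jq; apply: idealD => //; apply: idealN. Qed.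

Lemma colon_is_ideal J g : is_ideal J -> is_ideal (colon J g).
Proof.
move=> idJ; split=> [|p q Jp Jq|a p Jp]; rewrite /colon.
- by rewrite mul0r; apply: ideal0.
- by rewrite mulrDl; apply: idealD.
- by rewrite -mulrA; apply: idealM.
Qed.

Lemma ideal_sum J (T : eqType) (r : seq T) (P : pred T) (F : T -> S) :
  is_ideal J -> {in r, forall i, P i -> J (F i)} -> J (\sum_(i <- r | P i) F i).
Proof.
move=> idJ JF; rewrite big_seq_cond.
apply: (big_ind J) => [|p q|i /andP[]]; [exact: ideal0 | | exact: JF].
by move=> Jp Jq; apply: idealD.
Qed.

Lemma ideal_gen_sub G J :
  is_ideal J -> (forall p, G p -> J p) -> forall p, ideal_gen G p -> J p.
Proof.
move=> idJ GJ _ [s [sG ->]]; apply: ideal_sum => // u us _.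
by apply: idealM => //; apply/GJ/sG.
Qed.

Lemma ideal_mulmx J k r (v : 'rV[S]_k) (A : 'M[S]_(k, r)) :
  is_ideal J -> (forall a, J (v 0 a)) -> forall b, J ((v *m A) 0 b).
Proof.
move=> idJ Jv b; rewrite mxE; apply: ideal_sum => // a _ _.
by rewrite mulrC; apply: idealM.
Qed.

Definition seq_ideal (s : seq S) : S -> Prop := ideal_gen (fun p => p \in s).

Lemma seq_ideal_is_ideal s : is_ideal (seq_ideal s).
Proof. exact: ideal_gen_is_ideal. Qed.

Lemma seq_ideal_nil p : seq_ideal [::] p -> p = 0.
Proof.
by case=> -[|u s] [sG ->]; rewrite ?big_nil //; have := sG u (mem_head _ _).
Qed.

(** The elements [a * h + q] form an ideal containing [G]. This splits off a single generator, both
    for lists of linear forms and for the [f k]. *)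
Lemma ideal_gen_insert G G' h p :
    (forall g, G g -> g = h \/ G' g) -> ideal_gen G p ->
  exists a q, ideal_gen G' q /\ p = a * h + q.
Proof.
move=> GG'; have idG' := ideal_gen_is_ideal G'.
apply: (@ideal_gen_sub _
  (fun p => exists a q, ideal_gen G' q /\ p = a * h + q)).
  split=> [|_ _ [a [q [Gq ->]]] [b [r [Gr ->]]]|b _ [a [q [Gq ->]]]].
  - by exists 0, 0; rewrite mul0r addr0; split=> //; apply: ideal0.
  - exists (a + b), (q + r); rewrite mulrDl addrACA; split=> //.
    exact: idealD.
  - exists (b * a), (b * q); rewrite mulrDr mulrA; split=> //.
    exact: idealM.
move=> q /GG'[->|Gq].
  by exists 1, 0; rewrite mul1r addr0; split=> //; apply: ideal0.
by exists 0, q; rewrite mul0r add0r; split=> //; apply: ideal_gen_mem.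
Qed.

Lemma seq_ideal_cons l s p :
  seq_ideal (l :: s) p -> exists a q, seq_ideal s q /\ p = a * l + q.
Proof.
apply: ideal_gen_insert => g; rewrite inE => /predU1P[]; first by left.
by right.
Qed.

Lemma seq_ideal_sub s t p : {subset s <= t} -> seq_ideal s p -> seq_ideal t p.
Proof.
move=> st; apply: ideal_gen_sub; first exact: ideal_gen_is_ideal.
by move=> q /st tq; apply: ideal_gen_mem.
Qed.

(** Each [F i] involves finitely many generators. This replaces a possibly infinite set of linear
    forms by a list, on which induction is possible. *)
Lemma ideal_gen_finite G (T : finType) (F : T -> S) :
    (forall i, ideal_gen G (F i)) ->
  exists2 s : seq S, (forall g, g \in s -> G g) & forall i, seq_ideal s (F i).
Proof.
move=> GF; have [t /all_and2[tG tF]] := fin_all_exists GF.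
exists (flatten [seq [seq u.2 | u <- t i] | i <- enum T]).
  by move=> g /flatten_mapP[i _ /mapP[u tu ->]]; apply: tG tu.
move=> i; exists (t i); split=> // u tu; apply/flatten_mapP.
by exists i; rewrite ?mem_enum ?map_f.
Qed.

End Ideals.

(** * Homogeneous components of products and of generated ideals *)

Section Homogeneity.
Variables (K : fieldType) (n : nat).
Local Notation S := {mpoly K[n]}.
Implicit Types (p q l a g : S) (d e : nat).

Lemma pihomog_pihomog d e p :
  pihomog mdeg d (pihomog mdeg e p) = if e == d then pihomog mdeg d p else 0.
Proof.
case: eqP => [->|/eqP ne]; first by rewrite pihomog_dE ?pihomogP.
by rewrite (pihomog_ne0 ne) ?pihomogP.
Qed.

Lemma pihomogM d e a g :
  g \is e.-homog -> pihomog mdeg (d + e) (a * g) = pihomog mdeg d a * g.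
Proof.
move=> hg; rewrite [in LHS](pihomog_partitionE (leqnn (mmeasure mdeg a))).
rewrite [a in RHS](pihomog_partitionE (leqnn (mmeasure mdeg a))).
rewrite mulr_suml !raddf_sum mulr_suml; apply: eq_bigr => k _ /=.
have hkg := dhomogM (pihomogP mdeg k a) hg.
rewrite pihomog_pihomog; case: eqP => [<-|ne]; first exact: pihomog_dE.
by rewrite mul0r (pihomog_ne0 _ hkg) // eqn_add2r; apply/eqP.
Qed.

Lemma pihomogM_lt d e a g :
  (d < e)%N -> g \is e.-homog -> pihomog mdeg d (a * g) = 0.
Proof.
move=> lt_de hg; rewrite (pihomog_partitionE (leqnn (mmeasure mdeg a))).
rewrite mulr_suml raddf_sum big1 // => k _ /=.
rewrite (pihomog_ne0 _ (dhomogM (pihomogP mdeg k a) hg)) //.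
by rewrite gtn_eqF // ltn_addl.
Qed.

Lemma homogM1 d p l : p \is d.-homog -> l \is 1.-homog -> p * l \is d.+1.-homog.
Proof. by rewrite -[d.+1]addn1; apply: dhomogM. Qed.

Lemma pihomogM1 d p l :
  l \is 1.-homog -> pihomog mdeg d.+1 (p * l) = pihomog mdeg d p * l.
Proof. by rewrite -[d.+1]addn1; apply: pihomogM. Qed.

Lemma mcoeff0_homog d p : p \is d.+1.-homog -> mcoeff 0%MM p = 0.
Proof. by move=> hp; apply: (dhomog_nemf_coeff hp); rewrite /= mdeg0. Qed.

Lemma homog0_const p : p \is 0.-homog -> p = (mcoeff 0%MM p)%:MP.
Proof.
move=> hp; apply/mpolyP => m; rewrite mcoeffC.
have [->|nz_m] := eqVneq m 0%MM; first by rewrite mulr1.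
by rewrite mulr0 (dhomog_nemf_coeff hp) // mdeg_eq0.
Qed.

Lemma homog1_linear_form l :
  l \is 1.-homog -> l = \sum_(i < n) l@_U_(i) *: 'X_i.
Proof.
move=> hl; apply/mpolyP => m; rewrite raddf_sum /=.
have [/mdeg1P[i /eqP ->]|ne1] := boolP (mdeg m == 1%N).
  rewrite (bigD1 i) //= mcoeffZ mcoeffXU eqxx mulr1 big1 ?addr0 // => k ne_ki.
  by rewrite mcoeffZ mcoeffXU (negPf ne_ki) mulr0.
rewrite (dhomog_nemf_coeff hl) // big1 // => i _.
rewrite mcoeffZ mcoeffX; case: eqP => [def_m|_]; last by rewrite mulr0.
by rewrite -def_m mdeg1 in ne1.
Qed.

Lemma mpolyXi_homog1 (i : 'I_n) : ('X_i : S) \is 1.-homog.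
Proof. by rewrite dhomogX /= mdeg1. Qed.

Lemma pihomog_mulmx d k r (v : 'rV[S]_k) (A : 'M[S]_(k, r)) :
    (forall i j, A i j \is 1.-homog) ->
  map_mx (pihomog mdeg d.+1) (v *m A) = map_mx (pihomog mdeg d) v *m A.
Proof.
move=> hA; apply/rowP => b; rewrite !mxE raddf_sum /=.
by apply: eq_bigr => a _; rewrite !mxE pihomogM1.
Qed.

Lemma pihomog_row d k (v : 'rV[S]_k) :
  (forall i, v 0 i \is d.-homog) -> map_mx (pihomog mdeg d) v = v.
Proof. by move=> hv; apply/rowP => a; rewrite mxE pihomog_dE. Qed.

Lemma ideal_gen_pihomog (G : S -> Prop) d p :
    (forall g, G g -> g \is homog mdeg) ->
  ideal_gen G p -> ideal_gen G (pihomog mdeg d p).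
Proof.
move=> hG [t [tG ->]]; rewrite raddf_sum /=.
have idG := ideal_gen_is_ideal G; apply: ideal_sum => // u /tG Gu _.
have /homogP[e hu] := hG _ Gu; have [lt_de|le_ed] := ltnP d e.
  by rewrite (pihomogM_lt _ lt_de hu); apply: ideal0.
rewrite -(subnK le_ed) pihomogM //; apply: idealM => //.
exact: ideal_gen_mem.
Qed.

End Homogeneity.

(** * Ideals generated by linear forms *)

Section LinearIdeals.
Variables (K : fieldType) (n : nat).
Local Notation S := {mpoly K[n]}.
Implicit Types (s : seq S) (p l : S).

(** The identity and the substitution are [K]-algebra maps that agree modulo [J] on the variables,
    hence everywhere. *)
Lemma comp_mpoly_congr (J : S -> Prop) (lq : n.-tuple S) :
    is_ideal J -> (forall i, J ('X_i - tnth lq i)) ->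
  forall p, J (p - (p \mPo lq)).
Proof.
move=> idJ JX; have idJ0 := ideal0 idJ.
have JM p q : J (p - (p \mPo lq)) -> J (q - (q \mPo lq)) ->
    J (p * q - (p * q \mPo lq)).
  rewrite rmorphM /= => Jp Jq.
  have -> : p * q - (p \mPo lq) * (q \mPo lq) =
            q * (p - (p \mPo lq)) + (p \mPo lq) * (q - (q \mPo lq)).
    by rewrite !mulrBr [q * p]mulrC [q * _]mulrC addrA subrK.
  by apply: idealD => //; apply: idealM.
have J1 : J (1 - (1 \mPo lq)) by rewrite rmorph1 subrr.
elim/mpolyind => [|c m p _ _ Jp]; first by rewrite rmorph0 subrr.
rewrite rmorphD /= opprD addrACA; apply: idealD => //.
rewrite comp_mpolyZ -scalerBr -mul_mpolyC; apply: idealM => //.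
rewrite mpolyXE_id; apply: (big_ind (fun p => J (p - (p \mPo lq)))) => // i _.
elim: (m i) => [|k IHk] //; rewrite exprS; apply: JM => //.
by rewrite comp_mpolyXU -tnth_nth.
Qed.

(* Solving one linear form of [s] after the other for one of its variables
   presents S/(s) as a polynomial subring of S, namely the image of [phi]. *)
Lemma linear_elimination s :
    (forall g, g \in s -> g \is 1.-homog) ->
  exists phi : {rmorphism S -> S},
    [/\ forall l, l \is 1.-homog -> phi l \is 1.-homog,
        forall g, g \in s -> phi g = 0
      & forall p, seq_ideal s (p - phi p)].
Proof.
elim: s => [|l s IHs] s1.
  exists idfun; split=> // p; rewrite subrr.
  exact: ideal0 (seq_ideal_is_ideal _).
have /IHs[phi [phi1 phi0 phiK]] : forall g, g \in s -> g \is 1.-homog.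
  by move=> g sg; rewrite s1 // inE sg orbT.
have idls := seq_ideal_is_ideal (l :: s).
have sub_s p : seq_ideal s p -> seq_ideal (l :: s) p.
  by apply: seq_ideal_sub => g sg; rewrite inE sg orbT.
have hl : phi l \is 1.-homog by rewrite phi1 // s1 ?mem_head.
have Il : seq_ideal (l :: s) (phi l).
  rewrite -[phi l](subKr l); apply: idealB => //; last exact: sub_s.
  by apply: ideal_gen_mem; rewrite mem_head.
have [phil0|nz_phil] := eqVneq (phi l) 0.
  exists phi; split=> [//|g|p]; last exact: sub_s.
  by rewrite inE => /predU1P[->|/phi0].
have [t nz_t] : exists t, (phi l)@_U_(t) != 0.
  apply/existsP; apply: contraR nz_phil => /existsPn l0.
  rewrite (homog1_linear_form hl) big1 // => i _.
  by have:= l0 i; rewrite negbK => /eqP ->; rewrite scale0r.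
set c := (phi l)@_U_(t) in nz_t.
have hlE : phi l = c *: 'X_t + \sum_(k < n | k != t) (phi l)@_U_(k) *: 'X_k.
  by rewrite [LHS](homog1_linear_form hl) (bigD1 t).
(* Only ['X_t] is moved, by [c^-1 *: phi l]; as [c] is its coefficient in [phi l], the substitution
   sends [phi l] to [phi l - phi l = 0]. *)
pose lq := [tuple 'X_k - (if k == t then c^-1 *: phi l else 0) | k < n].
have lqE k : 'X_k \mPo lq = 'X_k - (if k == t then c^-1 *: phi l else 0).
  by rewrite comp_mpolyXU -tnth_nth tnth_mktuple.
exists (comp_mpoly lq \o phi : {rmorphism S -> S}); split=> /=.
- move=> p /phi1 /homog1_linear_form ->; rewrite raddf_sum.
  apply: rpred_sum => k _ /=; rewrite comp_mpolyZ; apply: rpredZ => /=.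
  rewrite lqE rpredB ?mpolyXi_homog1 //.
  by case: eqP => _; [apply: rpredZ | apply: dhomog0].
- move=> g; rewrite inE => /predU1P[->|/phi0 ->]; last exact: rmorph0.
  rewrite (congr1 (comp_mpoly lq) hlE) comp_mpolyD comp_mpolyZ lqE eqxx.
  rewrite scalerBr scalerA mulfV // scale1r {1}hlE raddf_sum /=.
  rewrite [X in _ + X](_ : _ = \sum_(k < n | k != t) (phi l)@_U_(k) *: 'X_k).
    by rewrite opprD addrA subrr sub0r addNr.
  by apply: eq_bigr => k /negPf ne_kt; rewrite comp_mpolyZ lqE ne_kt subr0.
- move=> p; rewrite -(subrKA (phi p)); apply: idealD => //.
    exact: sub_s.
  apply: comp_mpoly_congr => // i; rewrite tnth_mktuple subKr.
  case: eqP => _; last exact: ideal0.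
  by rewrite -mul_mpolyC; apply: idealM.
Qed.

(** The ideal is the kernel of the elimination map, whose target [S] is a domain. The dichotomy is
    the form used when a linear form is added: it is already in the ideal or regular modulo it. *)
Lemma seq_ideal_prime s p :
    (forall g, g \in s -> g \is 1.-homog) ->
  seq_ideal s p \/ forall q, seq_ideal s (p * q) -> seq_ideal s q.
Proof.
move=> /linear_elimination[phi [_ phi0 phiK]].
have ker q : phi q = 0 -> seq_ideal s q.
  by move=> q0; have:= phiK q; rewrite q0 subr0.
have [/ker|nz_p] := eqVneq (phi p) 0; [by left | right=> q [t [ts pq]]].
apply/ker/(mulfI nz_p); rewrite mulr0 -rmorphM pq rmorph_sum big_seq big1 //.
by move=> u /ts su; rewrite rmorphM /= (phi0 _ su) mulr0.
Qed.

(** By primality it suffices that ['X_i] lies outside the ideal, which evaluation at the [i]-th unit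
    vector detects. *)
Lemma variables_regular (r : seq 'I_n) i p :
    i \notin r -> seq_ideal [seq 'X_k | k <- r] ('X_i * p) ->
  seq_ideal [seq 'X_k | k <- r] p.
Proof.
move=> r'i.
have [||reg_Xi /reg_Xi //] := @seq_ideal_prime [seq 'X_k | k <- r] 'X_i.
  by move=> _ /mapP[k _ ->]; apply: mpolyXi_homog1.
move=> Xi; pose ev (q : S) := q.@[fun k => (k == i)%:R].
suff /(_ _ Xi) /eqP: forall q, seq_ideal [seq 'X_k | k <- r] q -> ev q = 0.
  by rewrite /ev mevalXU eqxx oner_eq0.
apply: ideal_gen_sub => [|_ /mapP[k rk ->]].
  split=> [|p1 q1 p0 q0|a q1 q0]; rewrite /ev ?meval0 //.
    by rewrite mevalD [p1.@[_]]p0 [q1.@[_]]q0 addr0.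
  by rewrite mevalM [q1.@[_]]q0 mulr0.
rewrite /ev mevalXU; case: eqP => // def_k.
by rewrite -def_k rk in r'i.
Qed.

Definition variables : seq S := [seq 'X_i | i <- enum 'I_n].

Lemma variables_homog1 g : g \in variables -> g \is 1.-homog.
Proof. by case/mapP=> i _ ->; apply: mpolyXi_homog1. Qed.

Lemma seq_ideal_variables p : seq_ideal variables p <-> mcoeff 0%MM p = 0.
Proof.
split=> [[s [sX ->]]|p0].
  rewrite raddf_sum big_seq big1 // => u /sX/mapP[i _ ->] /=.
  by rewrite rmorphM /= mcoeffX mnm1_eq0 mulr0.
have idX := seq_ideal_is_ideal variables.
rewrite (mpolyE p); apply: ideal_sum => // m mp _.
rewrite -mul_mpolyC; apply: idealM => //.
have [i mi] : exists i, m i != 0%N.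
  apply/existsP; apply: contraTT mp => /existsPn m0.
  suff -> : m = 0%MM by rewrite mcoeff_msupp p0 eqxx.
  by apply/mnmP => i; have:= m0 i; rewrite negbK mnm0E => /eqP.
rewrite -[m](@submK _ U_(i)%MM) ?lep1mP // mpolyXD; apply: idealM => //.
by apply: ideal_gen_mem; apply/mapP; exists i; rewrite ?mem_enum.
Qed.

End LinearIdeals.

(** * The Koszul complex *)

Section Koszul.
Variables (K : fieldType) (n : nat).
Local Notation S := {mpoly K[n]}.

Record free_complex := FreeComplex {
  crank : nat -> nat;
  cdiff : forall i, 'M[S]_(crank i.+1, crank i)
}.

Definition unit_complex : free_complex :=
  FreeComplex (fun i => 0 : 'M[S]_(0, (i == 0))).

Definition cone_rank (r : nat -> nat) (i : nat) : nat :=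
  if i is i'.+1 then (r i + r i')%N else r 0.

(* The differential of the mapping cone of multiplication by [x] is
   (a, b) |-> (d a + x b, - d b). *)
Definition cone_diff (x : S) (C : free_complex) (i : nat) :
    'M[S]_(cone_rank (crank C) i.+1, cone_rank (crank C) i) :=
  match i with
  | 0 => col_mx (cdiff C 0) x%:M
  | i'.+1 => block_mx (cdiff C i'.+1) 0 x%:M (- cdiff C i')
  end.

Definition cone (x : S) (C : free_complex) : free_complex :=
  FreeComplex (cone_diff x C).

Definition koszul (xs : seq S) : free_complex :=
  foldr cone unit_complex xs.

Lemma koszul_rank0 xs : crank (koszul xs) 0 = 1.
Proof. by elim: xs. Qed.

Lemma koszul_homog1 xs :
    (forall x, x \in xs -> x \is 1.-homog) ->
  forall i a b, cdiff (koszul xs) i a b \is 1.-homog.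
Proof.
elim: xs => [|x xs IHxs] xs1 i; first by case.
have {}IHxs k a b : cdiff (koszul xs) k a b \is 1.-homog.
  by apply: IHxs => y xs_y; rewrite xs1 // inE xs_y orbT.
have hx k (a b : 'I_k) : (x%:M : 'M[S]_k) a b \is 1.-homog.
  rewrite mxE; case: (a == b); last exact: dhomog0.
  by rewrite mulr1n xs1 // mem_head.
case: i => [|i] a b /=; rewrite mxE; case: splitP => k _ //.
all: rewrite mxE; case: splitP => l _ //; rewrite ?mxE ?dhomog0 //.
by rewrite dhomogN.
Qed.

Lemma koszul_complex xs i :
  cdiff (koszul xs) i.+1 *m cdiff (koszul xs) i = 0.
Proof.
elim: xs i => [|x xs IHxs] i; first by rewrite mul0mx.
case: i => [|i] /=.
  rewrite mul_block_col IHxs mul0mx addr0 mulNmx.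
  by rewrite mul_scalar_mx mul_mx_scalar subrr col_mx0.
rewrite mulmx_block !(mulNmx, mulmxN) !IHxs mul_scalar_mx.
by rewrite !mul_mx_scalar !(mul0mx, mulmx0, scaler0, oppr0, addr0, add0r, subrr)
  block_mx0.
Qed.

Lemma seq_ideal_cons_row x s k (v : 'rV[S]_k) :
    (forall i, seq_ideal (x :: s) (v 0 i)) ->
  exists c q : 'rV[S]_k, (forall i, seq_ideal s (q 0 i)) /\ v = x *: c + q.
Proof.
move=> xs_v; have [c] := fin_all_exists (fun i => seq_ideal_cons (xs_v i)).
case/fin_all_exists=> q /all_and2[sq vE].
exists (\row_i c i), (\row_i q i); split=> [i|]; first by rewrite mxE.
by apply/rowP => i; rewrite !mxE vE mulrC.
Qed.

Lemma koszul_boundary0 xs (v : 'rV[S]_(crank (koszul xs) 0)) :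
  (forall i, seq_ideal xs (v 0 i)) <->
  exists w, v = w *m cdiff (koszul xs) 0.
Proof.
elim: xs v => [|x xs IHxs] /= v.
  split=> [v0|[w ->] i].
    exists 0; rewrite mul0mx; apply/rowP => i; rewrite mxE.
    exact: seq_ideal_nil.
  by rewrite mulmx0 mxE; apply: ideal0 (seq_ideal_is_ideal _).
split=> [/seq_ideal_cons_row[c [q [/IHxs[w ->] ->]]]|[w ->] i].
  by exists (row_mx w c); rewrite mul_row_col mul_mx_scalar addrC.
rewrite -[w]hsubmxK mul_row_col mul_mx_scalar !mxE.
have idxs := seq_ideal_is_ideal (x :: xs); apply: idealD => //.
  have /(_ i): forall i, seq_ideal xs ((lsubmx w *m cdiff (koszul xs) 0) 0 i).
    by apply/IHxs; exists (lsubmx w).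
  by rewrite mxE; apply: seq_ideal_sub => g xs_g; rewrite inE xs_g orbT.
by rewrite mulrC; apply: idealM => //; apply: ideal_gen_mem; rewrite mem_head.
Qed.

(** Regularity is read from the tail of the list, matching the order in which [koszul] takes
    cones. *)
Fixpoint regular_sequence (xs : seq S) : Prop :=
  if xs is x :: xs' then
    regular_sequence xs' /\
    forall p, seq_ideal xs' (x * p) -> seq_ideal xs' p
  else True.

(** The long exact sequence of the cone made explicit: for a cycle [(a, b)], [b] is a boundary
    [d c], by regularity of [x] in the lowest degree and by induction above it; then [a + x c] is a
    cycle of the smaller complex. *)
Lemma koszul_exact xs i (v : 'rV[S]_(crank (koszul xs) i.+1)) :
    regular_sequence xs ->
  v *m cdiff (koszul xs) i = 0 <->
  exists w, v = w *m cdiff (koszul xs) i.+1.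
Proof.
move=> reg_xs; split; last first.
  by case=> w ->; rewrite -mulmxA koszul_complex mulmx0.
elim: xs i v reg_xs => [|x xs IHxs] /= i v.
  by exists 0; rewrite mul0mx; apply/rowP; case.
case=> /IHxs{}IHxs reg_x.
have lift_cycle k (a : 'rV_(crank (koszul xs) k.+1)) c :
    a *m cdiff (koszul xs) k + x *: (c *m cdiff (koszul xs) k) = 0 ->
  exists w, a = w *m cdiff (koszul xs) k.+1 - x *: c.
  rewrite scalemxAl -mulmxDl => /IHxs[w def_w]; exists w.
  by rewrite -def_w addrK.
case: i v => [|i] v /=; rewrite -[v]hsubmxK.
  set a := lsubmx v; set b := rsubmx v.
  rewrite mul_row_col mul_mx_scalar => ab0.
  have [c def_b] : exists c, b = c *m cdiff (koszul xs) 0.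
    apply/koszul_boundary0 => j; apply: reg_x.
    have -> : x * b 0 j = - (a *m cdiff (koszul xs) 0) 0 j.
      apply/eqP; rewrite -addr_eq0 addrC.
      by have /rowP/(_ j) := ab0; rewrite !mxE => ->.
    apply: idealN; first exact: seq_ideal_is_ideal.
    by move: j; apply/koszul_boundary0; exists a.
  rewrite def_b in ab0 *; have [w ->] := lift_cycle _ _ _ ab0.
  exists (row_mx w (- c)).
  rewrite mul_row_block mul_mx_scalar mulmx0 add0r mulmxN mulNmx opprK.
  by rewrite scalerN.
set a := lsubmx v; set b := rsubmx v.
rewrite mul_row_block mul_mx_scalar mulmx0 add0r mulmxN.
rewrite -[0]row_mx0 => /eq_row_mx[ab0 /eqP].
rewrite oppr_eq0 => /eqP/IHxs[c def_b].
rewrite def_b in ab0 *; have [w ->] := lift_cycle _ _ _ ab0.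
exists (row_mx w (- c)).
rewrite mul_row_block mul_mx_scalar mulmx0 add0r mulmxN mulNmx opprK.
by rewrite scalerN.
Qed.

Lemma variables_regular_sequence : regular_sequence (variables K n).
Proof.
rewrite /variables; elim: (enum _) (enum_uniq 'I_n) => //= i r IHr.
by case/andP=> r'i /IHr reg_r; split=> // p; apply: variables_regular.
Qed.

End Koszul.

(** * The Koszul resolution of [K] and Koszul homology modulo linear forms *)

Section KoszulResolution.
Variables (K : fieldType) (n : nat).
Local Notation S := {mpoly K[n]}.

Local Notation C := (koszul (variables K n)).
Local Notation rank := (crank C).
Local Notation diff := (cdiff C).

Lemma koszul_variables_homog1 i a b : diff i a b \is 1.-homog.
Proof. by apply: koszul_homog1 => x; apply: variables_homog1. Qed.

(** The rank is a variable with an equation because [rank 0] equals 1 by induction on the list, not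
    by computation. *)
Lemma residue_augmentation r (v : 'rV[S]_r) : r = 1 ->
  residue_mx v *m const_mx 1 = 0 :> 'M[K]_1 <->
  forall i, mcoeff 0%MM (v 0 i) = 0.
Proof.
move=> r1; rewrite {}r1 in v *.
have -> : residue_mx v *m const_mx 1 = (mcoeff 0%MM (v 0 0))%:M.
  by apply/matrixP => i j; rewrite !mxE big_ord1 !mxE !ord1 mulr1.
split=> [/matrixP/(_ 0 0) | v0]; last by rewrite v0 raddf0.
by rewrite !mxE => v0 i; rewrite ord1.
Qed.

(** The basis in homological degree [i] is placed in degree [i], because the differentials have
    linear entries. *)
Program Definition koszul_resolution : graded_free_resolution_of_K K n :=
  @GradedFreeResolution K n rank (fun i _ => i) diff (const_mx 1) _ _ _ _ _.
Next Obligation.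
by rewrite /shifted_homog leqnSn subSnn koszul_variables_homog1.
Qed.
Next Obligation.
move: (koszul_rank0 (variables K n)); set r := rank 0 => ->.
exists (const_mx (c 0 0)%:MP); apply/matrixP => i j.
by rewrite !mxE big_ord1 !mxE mcoeffC eqxx mulr1 mulr1 !ord1.
Qed.
Next Obligation.
apply: (iff_trans (residue_augmentation v (koszul_rank0 _))).
apply: iff_trans (koszul_boundary0 v).
by split=> v0 i; apply/seq_ideal_variables.
Qed.
Next Obligation.
apply: koszul_exact; exact: variables_regular_sequence.
Qed.

Lemma koszul_boundary_homog i e (v : 'rV[S]_(rank i)) :
    (forall a, v 0 a \is e.+1.-homog) ->
    (exists w, v = w *m diff i) ->
  exists2 w : 'rV[S]_(rank i.+1),
    forall a, w 0 a \is e.-homog & v = w *m diff i.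
Proof.
move=> hv [w def_v]; exists (map_mx (pihomog mdeg e) w) => [a|].
  by rewrite mxE pihomogP.
rewrite -pihomog_mulmx; last exact: koszul_variables_homog1.
by rewrite -def_v pihomog_row.
Qed.

(** Cycles of the Koszul complex with coefficients in [S/J], represented by rows over [S]. *)
Definition cycle_mod (J : S -> Prop) (i : nat) : 'rV[S]_(rank i) -> Prop :=
  match i with
  | 0 => fun _ => True
  | i'.+1 => fun v => forall b, J ((v *m diff i') 0 b)
  end.

(* The Koszul homology of S/(s) vanishes in positive coefficient degree. By
   induction on [s]: a cycle [u] modulo (l, s), with l regular modulo (s),
   satisfies d u = l c modulo (s) for a cycle c modulo (s) of the same
   coefficient degree; as c = d z modulo (s), the chain u - l z is a cycle
   modulo (s). *)
Lemma koszul_linear_acyclic s i e (u : 'rV[S]_(rank i)) :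
    (forall g, g \in s -> g \is 1.-homog) ->
    (forall a, u 0 a \is e.+1.-homog) -> cycle_mod (seq_ideal s) u ->
  exists2 w : 'rV[S]_(rank i.+1), forall a, w 0 a \is e.-homog
           & forall a, seq_ideal s ((u - w *m diff i) 0 a).
Proof.
elim: s i e u => [|l s IHs] i e u s1 hu.
  move=> cyc_u; have [|w hw ->] := koszul_boundary_homog hu; last first.
    exists w => // a; rewrite subrr mxE.
    exact: ideal0 (seq_ideal_is_ideal _).
  case: i u hu cyc_u => [|i] u hu /= cyc_u.
    apply/koszul_boundary0 => a; apply/seq_ideal_variables.
    exact: mcoeff0_homog (hu a).
  apply/koszul_exact; first exact: variables_regular_sequence.
  by apply/rowP => b; rewrite [RHS]mxE; apply: seq_ideal_nil.
have s1' g : g \in s -> g \is 1.-homog by move=> sg; rewrite s1 // inE sg orbT.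
have sub_s p : seq_ideal s p -> seq_ideal (l :: s) p.
  by apply: seq_ideal_sub => g sg; rewrite inE sg orbT.
have [ids idls] := (seq_ideal_is_ideal s, seq_ideal_is_ideal (l :: s)).
move=> cyc_u; have [s_l|reg_l] := seq_ideal_prime l s1'.
  have sub_ls p : seq_ideal (l :: s) p -> seq_ideal s p.
    apply: ideal_gen_sub => // g; rewrite inE => /predU1P[-> //|].
    exact: ideal_gen_mem.
  have [|w hw uw] := IHs i e u s1' hu.
    by case: i u {hu} cyc_u => //= i u cyc_u b; apply: sub_ls.
  by exists w => // a; apply: sub_s.
have ls_l : seq_ideal (l :: s) l by apply: ideal_gen_mem; rewrite mem_head.
have [z hz cyc_uz] : exists2 z : 'rV[S]_(rank i), forall a, z 0 a \is e.-homog
                   & cycle_mod (seq_ideal s) (u - l *: z). 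
  case: i u hu cyc_u => [|i] /= u hu cyc_u.
    by exists 0 => [a|]; rewrite ?mxE ?dhomog0.
  have huD b : (u *m diff i) 0 b \is e.+2.-homog.
    rewrite mxE; apply: rpred_sum => a _.
    by apply: homogM1 => //; apply: koszul_variables_homog1.
  have [c [q [sq uD]]] := seq_ideal_cons_row cyc_u.
  (* Taking components in the degree of [d u] makes [c] and [q] homogeneous. *)
  have {}uD : u *m diff i = l *: map_mx (pihomog mdeg e.+1) c
                             + map_mx (pihomog mdeg e.+2) q.
    rewrite -[LHS](pihomog_row huD) uD; apply/rowP => b; rewrite !mxE raddfD /=.
    by rewrite mulrC pihomogM1 ?s1 ?mem_head // mulrC.
  have {sq} : forall b, seq_ideal s (map_mx (pihomog mdeg e.+2) q 0 b).
    move=> b; rewrite mxE; apply: ideal_gen_pihomog; last exact: sq.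
    by move=> g /s1' hg; apply/homogP; exists 1.
  have: forall b, map_mx (pihomog mdeg e.+1) c 0 b \is e.+1.-homog.
    by move=> b; rewrite mxE; apply: pihomogP.
  move: (map_mx _ c) (map_mx _ q) uD => {}c {}q uD hc sq.
  have [|z hz cz] := IHs i e c s1' hc.
    (* Applying [d] to [d u = l c + q] gives [l (d c) = - d q], which is zero modulo [s]; cancelling
       the regular [l] makes [c] a cycle modulo [s]. *)
    case: i u hu cyc_u huD c q uD hc sq => [//|i] u _ _ _ c q uD _ sq b /=.
    apply: reg_l; have -> : l * (c *m diff i) 0 b = - (q *m diff i) 0 b.
      apply/eqP; rewrite -addr_eq0; apply/eqP.
      have /rowP/(_ b) := congr1 (mulmx u) (koszul_complex (variables K n) i).
      by rewrite mulmxA uD mulmxDl -scalemxAl mulmx0 !mxE.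
    by apply: idealN => //; apply: ideal_mulmx.
  exists z => // b; rewrite mulmxBl uD -scalemxAl addrAC -scalerBr mxE.
  by apply: idealD => //; rewrite mxE; apply: idealM.
have huz a : (u - l *: z) 0 a \is e.+1.-homog.
  by rewrite !mxE rpredB // mulrC homogM1 ?s1 ?mem_head.
have [w hw uzw] := IHs i e _ s1' huz cyc_uz.
exists w => // a.
have -> : u - w *m diff i = l *: z + (u - l *: z - w *m diff i).
  by rewrite addrA [l *: z + _]addrC subrK.
rewrite mxE; apply: idealD => //; last exact: sub_s.
by rewrite mxE mulrC; apply: idealM.
Qed.

End KoszulResolution.

(** * Linear quotients *)

Section LinearQuotients.
Variables (K : fieldType) (n m : nat) (f : 'I_m -> {mpoly K[n]}).
Variable (dg : 'I_m -> nat).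
Hypothesis f_homog : forall k, f k \is (dg k).-homog.
Local Notation S := {mpoly K[n]}.
Local Notation rank := (crank (koszul (variables K n))).
Local Notation diff := (cdiff (koszul (variables K n))).

(** The bound [t] is a natural number so that induction can reach [m], where all [f k] with [P k]
    occur; [P] will select the generators of bounded degree. *)
Definition initial_ideal (P : pred 'I_m) (t : nat) : S -> Prop :=
  ideal_gen (subfamily f (fun k : 'I_m => (k < t)%N && P k)).

Lemma subfamily_homog (P : pred 'I_m) g : subfamily f P g -> g \is homog mdeg.
Proof. by case=> k _ ->; apply/homogP; exists (dg k). Qed.

Lemma ideal_gen_subfamily (P : pred 'I_m) p :
  ideal_gen (subfamily f P) p -> exists c, p = \sum_(k | P k) c k * f k.
Proof.
apply: (ideal_gen_sub (J := fun p => exists c, p = \sum_(k | P k) c k * f k)).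
  split=> [|_ _ [c ->] [c' ->]|a _ [c ->]].
  - by exists (fun=> 0); rewrite big1 // => k _; rewrite mul0r.
  - exists (fun k => c k + c' k); rewrite -big_split.
    by apply: eq_bigr => k _; rewrite mulrDl.
  - exists (fun k => a * c k); rewrite mulr_sumr.
    by apply: eq_bigr => k _; rewrite mulrA.
move=> _ [k Pk ->]; exists (fun i => (i == k)%:R).
rewrite (bigD1 k) //= eqxx mul1r big1 ?addr0 // => i /andP[_ /negPf ->].
exact: mul0r.
Qed.

Lemma initial_ideal_sub (P Q : pred 'I_m) t u p :
    (forall k : 'I_m, (k < t)%N && P k -> (k < u)%N && Q k) ->
  initial_ideal P t p -> initial_ideal Q u p.
Proof.
move=> PQ; apply: ideal_gen_sub; first exact: ideal_gen_is_ideal.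
by move=> _ [k /PQ Qk ->]; apply: ideal_gen_mem; exists k.
Qed.

(** * Koszul acyclicity by induction along the generators *)

Section Acyclicity.
Variables (P : pred 'I_m) (j : nat).
Hypothesis dgP : forall k, P k -> (dg k <= j)%N.
Hypothesis P_linquot : forall k, P k ->
  generated_by_linear_forms (colon (initial_ideal P k) (f k)).

(* Modulo the previous generators, a cycle is f_k u with u a cycle modulo a
   linear ideal; the degree bound makes the coefficients of u non-constant. *)
Lemma initial_ideal_acyclic t i e (v : 'rV[S]_(rank i)) :
    (j <= e)%N -> (forall a, v 0 a \is e.+1.-homog) ->
    (forall a, initial_ideal P t (v 0 a)) ->
    tensor_cycle (P := koszul_resolution K n) v ->
  exists2 w : 'rV[S]_(rank i.+1),
    forall a, initial_ideal P t (w 0 a) /\ w 0 a \is e.-homog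
  & v = w *m diff i.
Proof.
move=> le_je; elim: t v => [|t IHt] v hv Jv cyc_v.
  exists 0 => [a|].
    by rewrite mxE dhomog0; split=> //; apply: ideal0 (ideal_gen_is_ideal _).
  rewrite mul0mx; apply/rowP => a; rewrite mxE.
  by have [c ->] := ideal_gen_subfamily (Jv a); rewrite big_pred0.
have idJ u : is_ideal (initial_ideal P u) by apply: ideal_gen_is_ideal.
have subJ p : initial_ideal P t p -> initial_ideal P t.+1 p.
  by apply: initial_ideal_sub => k /andP[lt_kt ->]; rewrite ltnS ltnW.
(* Without a selected generator of index [t], the ideals for [t] and [t.+1] coincide. *)
have [/existsP[k /andP[/eqP def_k Pk]]|no_k] :=
    boolP [exists k : 'I_m, (k == t :> nat) && P k]; last first.
  have [a||w hw ->] := IHt v hv.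
  - apply: initial_ideal_sub (Jv a) => k /andP[le_kt Pk].
    rewrite Pk andbT ltn_neqAle -ltnS le_kt andbT.
    by apply: contra no_k => kt; apply/existsP; exists k; rewrite kt.
  - exact: cyc_v.
  by exists w => // a; have [/subJ] := hw a.
have Jfk : initial_ideal P t.+1 (f k).
  by apply: ideal_gen_mem; exists k; rewrite // def_k ltnSn Pk.
have [c [q [Jq def_v]]] : exists c q : 'rV[S]_(rank i),
    (forall a, initial_ideal P t (q 0 a)) /\ v = f k *: c + q.
  have split_v a : exists c q, initial_ideal P t q /\ v 0 a = c * f k + q.
    apply: ideal_gen_insert (Jv a) => _ [l /andP[le_lt Pl] ->].
    move: le_lt; rewrite ltnS leq_eqVlt -def_k => /predU1P[/ord_inj ->|lt_lk].
      by left.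
    by right; exists l; rewrite // lt_lk.
  have [c] := fin_all_exists split_v; case/fin_all_exists=> q /all_and2[Jq vE].
  exists (\row_a c a), (\row_a q a); split=> [a|]; first by rewrite mxE.
  by apply/rowP => a; rewrite !mxE vE mulrC.
(* Since [dg k <= j <= e], the cofactors of [f k] have degree [r.+1], positive as
   [koszul_linear_acyclic] requires. *)
have le_de := leq_trans (dgP Pk) le_je; set r := (e - dg k)%N.
have {}def_v : v = f k *: map_mx (pihomog mdeg r.+1) c
                   + map_mx (pihomog mdeg e.+1) q.
  rewrite -[LHS](pihomog_row hv) def_v; apply/rowP => a; rewrite !mxE raddfD /=.
  by rewrite mulrC -{1}(subnK le_de) -addSn pihomogM // mulrC.
have {Jq}: forall a, initial_ideal P t (map_mx (pihomog mdeg e.+1) q 0 a).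
  move=> a; rewrite mxE; apply: ideal_gen_pihomog; last exact: Jq.
  exact: subfamily_homog.
have: forall a, map_mx (pihomog mdeg r.+1) c 0 a \is r.+1.-homog.
  by move=> a; rewrite mxE; apply: pihomogP.
move: (map_mx _ c) (map_mx _ q) def_v => {}c {}q def_v hc Jq.
have [L [L1 colonL]] := P_linquot Pk.
(* From [d v = 0], [f k] times [d c] equals [- d q], so [d c] has entries in the colon ideal. In
   homological degree 0 the empty list will do. *)
have [s sL cyc_c] : exists2 s : seq S, (forall g, g \in s -> L g)
                                     & cycle_mod (seq_ideal s) c.
  case: i v {IHt hv Jv} cyc_v c q def_v {hc} Jq => [|i] v /= cyc_v c q def_v Jq.
    by exists [::].
  apply: ideal_gen_finite => b; apply/colonL; rewrite /colon def_k.
  have -> : (c *m diff i) 0 b * f k = - (q *m diff i) 0 b.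
    apply/eqP; rewrite -addr_eq0; apply/eqP.
    by have /rowP/(_ b) := cyc_v; rewrite def_v mulmxDl -scalemxAl !mxE mulrC.
  by apply: idealN => //; apply: ideal_mulmx.
have [w hw cw] := koszul_linear_acyclic (fun g sg => L1 g (sL g sg)) hc cyc_c.
(* Subtracting the boundary of [f k *: w] leaves [f k *: (c - d w) + q]; as [c - d w] has entries in
   the colon ideal, only the previous generators remain. *)
pose v' := v - f k *: w *m diff i.
have [a|a||w' hw' def_v'] := IHt v'.
- rewrite /v' -scalemxAl !mxE rpredB // -(subnKC le_de) -addnS.
  apply: dhomogM => //; apply: rpred_sum => b _.
  by apply: homogM1 => //; apply: koszul_variables_homog1.
- have -> : v' = f k *: (c - w *m diff i) + q.
    by rewrite /v' def_v scalerBr scalemxAl addrAC.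
  rewrite mxE; apply: idealD => //; rewrite mxE mulrC -def_k.
  apply: (ideal_gen_sub (J := colon (initial_ideal P k) (f k))) (cw a).
    exact: colon_is_ideal.
  by move=> g /sL Lg; apply/colonL; apply: ideal_gen_mem.
- case: i v {IHt hv Jv} cyc_v c q w def_v {hc Jq cyc_c hw cw} @v'
    => [//|i] v /= cyc_v c q w _.
  by rewrite mulmxBl cyc_v -mulmxA koszul_complex mulmx0 subr0.
exists (f k *: w + w') => [a|]; last by rewrite mulmxDl -def_v' addrC subrK.
have [/subJ Jw' hw'a] := hw' a; rewrite !mxE; split.
  by apply: idealD => //; rewrite mulrC; apply: idealM.
by rewrite rpredD // -(subnKC le_de); apply: dhomogM.
Qed.

End Acyclicity.

(** * Minimality, truncation by degree, and the components of [I] *)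

Section MinimalGenerators.
Variable (I : S -> Prop).
Hypotheses (f_min : minimal_homogeneous_generators f I)
           (f_linquot : linear_quotients f I).

(** Otherwise the indices other than [k] would still generate [I]. *)
Lemma minimal_generator k : ~ ideal_gen (subfamily f (fun l => l != k)) (f k).
Proof.
move=> fk; have [[_ genI] minI] := f_min.
suff /minI/setP/(_ k): same_ideal I (ideal_gen (subfamily f (mem [set~ k]))).
  by rewrite !inE eqxx.
move=> p; rewrite genI; split; apply: ideal_gen_sub.
- exact: ideal_gen_is_ideal.
- move=> _ [l _ ->]; have [->|ne_lk] := eqVneq l k.
    apply: ideal_gen_sub fk; first exact: ideal_gen_is_ideal.
    move=> _ [i ne_ik ->]; apply: ideal_gen_mem; exists i => //=.
    by rewrite !inE.
  by apply: ideal_gen_mem; exists l; rewrite //= !inE.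
- exact: ideal_gen_is_ideal.
- by move=> _ [l _ ->]; apply: ideal_gen_mem; exists l.
Qed.

(* A generator of degree deg f_k + 1 in an expression of l f_k would have a
   constant coefficient, contradicting minimality. *)
Lemma linear_multiple_initial_ideal j k l :
    (dg k <= j)%N -> l \is 1.-homog ->
    initial_ideal predT k (l * f k) ->
  initial_ideal (fun i => dg i <= j)%N k (l * f k).
Proof.
move=> dg_k hl /ideal_gen_subfamily[c lfk].
have idJ : is_ideal (initial_ideal (fun i => dg i <= j)%N k).
  exact: ideal_gen_is_ideal.
have hlfk : l * f k \is (dg k).+1.-homog by rewrite mulrC; apply: homogM1.
rewrite -(pihomog_dE hlfk) lfk raddf_sum /=.
apply: ideal_sum => // i _ /andP[lt_ik _].
have [le_ij|lt_ji] := leqP (dg i) j.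
  apply: ideal_gen_pihomog; first exact: subfamily_homog.
  by apply: idealM => //; apply: ideal_gen_mem; exists i; rewrite // lt_ik.
(* Here [dg i > dg k]: either [dg i = dg k + 1] and the relevant component of [c i] is a constant,
   or [dg i] is larger and the term vanishes. *)
have:= leq_ltn_trans dg_k lt_ji; rewrite leq_eqVlt => /predU1P[def_di|lt_di].
  have := pihomogM 0 (c i) (f_homog i); rewrite add0n -def_di => cfi.
  have := homog0_const (pihomogP mdeg 0 (c i)).
  set a := mcoeff _ _ => def_a; have [a0|nz_a] := eqVneq a 0.
    by rewrite cfi def_a a0 mpolyC0 mul0r; apply: ideal0.
  have [] := @minimal_generator i.
  have -> : f i = a^-1%:MP * (a%:MP * f i).
    by rewrite mulrA -mpolyCM mulVf // mul1r.
  have idI : is_ideal (ideal_gen (subfamily f (fun l => l != i))).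
    exact: ideal_gen_is_ideal.
  apply: idealM => //; rewrite -def_a -cfi.
  (* Solving the relation in degree [dg k + 1] for the term of [f i] leaves multiples of [f k] and
     of other [f t], all of index different from [i]. *)
  have /eqP := congr1 (pihomog mdeg (dg k).+1) lfk.
  rewrite (pihomog_dE hlfk) raddf_sum (bigD1 i) /= ?lt_ik //.
  rewrite -subr_eq => /eqP <-; apply: idealB => //.
    apply: idealM => //; apply: ideal_gen_mem; exists k => //.
    by rewrite neq_ltn lt_ik orbT.
  apply: ideal_sum => // t _ /andP[_ ne_ti].
  apply: ideal_gen_pihomog; first exact: subfamily_homog.
  by apply: idealM => //; apply: ideal_gen_mem; exists t.
by rewrite (pihomogM_lt _ lt_di) //; apply: ideal0.
Qed.

(** The same linear forms [L] work: the truncated colon ideal lies in the full one, generated by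
    [L], and contains [L] by [linear_multiple_initial_ideal]. *)
Lemma degree_truncation_linear_quotients j k : (dg k <= j)%N ->
  generated_by_linear_forms
    (colon (initial_ideal (fun i => dg i <= j)%N k) (f k)).
Proof.
move=> le_kj; set J := initial_ideal _ k.
have idJ : is_ideal J by apply: ideal_gen_is_ideal.
have [k0|k_gt0] := posnP k.
  (* For the first generator the initial ideal is zero, and so is the colon ideal, since minimality
     makes [f k] nonzero; the empty set generates it. *)
  exists (fun=> False); split=> // p; split=> [|[[|u s] [sF ->]]]; last first.
  - by case: (sF u (mem_head _ _)).
  - by rewrite /colon big_nil mul0r; apply: ideal0.
  case/ideal_gen_subfamily=> c.
  rewrite big_pred0 => [/eqP|i]; last by rewrite k0.
  rewrite mulf_eq0 => /orP[/eqP ->|/eqP fk0].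
    exact: ideal0 (ideal_gen_is_ideal _).
  have [] := @minimal_generator k; rewrite fk0.
  exact: ideal0 (ideal_gen_is_ideal _).
have [_ /(_ k k_gt0)[L [L1 colonL]]] := f_linquot.
have JE p : ideal_gen (subfamily f (fun i : 'I_m => (i < k)%N)) p <->
            initial_ideal predT k p.
  split; apply: ideal_gen_sub; try exact: ideal_gen_is_ideal.
    by move=> _ [i lt_ik ->]; apply: ideal_gen_mem; exists i; rewrite ?lt_ik.
  by move=> _ [i /andP[lt_ik _] ->]; apply: ideal_gen_mem; exists i.
exists L; split=> // p; split=> [Jp|].
  apply/colonL/JE; apply: initial_ideal_sub Jp => i /andP[-> //].
apply: (ideal_gen_sub (J := colon J (f k))) => [|l Ll].
  exact: colon_is_ideal.
apply: linear_multiple_initial_ideal => //; first exact: L1.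
by apply/JE/colonL/ideal_gen_mem.
Qed.

Lemma ideal_component_low_degree j e p :
  (e < j)%N -> ideal_component j I p -> p \is e.-homog -> p = 0.
Proof.
move=> lt_ej [s [sI ->]] hp; rewrite -(pihomog_dE hp) raddf_sum big_seq big1 //.
by move=> u /sI[_ hu]; apply: pihomogM_lt hu.
Qed.

(** Generators of degree above [j] contribute nothing to an element of degree [j]. *)
Lemma ideal_component_sub j p :
  ideal_component j I p -> initial_ideal (fun i => dg i <= j)%N m p.
Proof.
have idJ : is_ideal (initial_ideal (fun i => dg i <= j)%N m).
  exact: ideal_gen_is_ideal.
apply: ideal_gen_sub => // g [Ig hg]; have [[_ genI] _] := f_min.
have /ideal_gen_subfamily[c def_g] := (genI g).1 Ig.
rewrite -(pihomog_dE hg) def_g raddf_sum; apply: ideal_sum => // i _ _ /=.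
have [le_ij|lt_ji] := leqP (dg i) j; last first.
  by rewrite (pihomogM_lt _ lt_ji) //; apply: ideal0.
apply: ideal_gen_pihomog; first exact: subfamily_homog.
by apply: idealM => //; apply: ideal_gen_mem; exists i; rewrite // ltn_ord.
Qed.

(** The cofactor of [f i] has degree [e - dg i >= j - dg i]; variables are split off it until [f i]
    times the rest has degree [j]. *)
Lemma ideal_component_high_degree j e p :
    (j <= e)%N -> p \is e.-homog ->
    initial_ideal (fun i => dg i <= j)%N m p -> ideal_component j I p.
Proof.
move=> le_je hp /ideal_gen_subfamily[c def_p].
have idM : is_ideal (ideal_component j I) by apply: ideal_gen_is_ideal.
rewrite -(pihomog_dE hp) def_p raddf_sum; apply: ideal_sum => // i _ /=.
case/andP=> _ le_ij; rewrite -{1}(subnK (leq_trans le_ij le_je)) pihomogM //.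
have: pihomog mdeg (e - dg i) (c i) \is (e - j + (j - dg i))%N.-homog.
  by rewrite addnBA // subnK // pihomogP.
move: (pihomog _ _ _) => {p hp def_p c}p; elim: (e - j)%N p => [|r IHr] p hp.
  apply: ideal_gen_mem; split; last by rewrite -(subnK le_ij); apply: dhomogM.
  have [[_ genI] _] := f_min; apply/genI; apply: idealM.
    exact: ideal_gen_is_ideal.
  by apply: ideal_gen_mem; exists i.
have /seq_ideal_variables[s [sX def_p]] := mcoeff0_homog hp.
rewrite -(pihomog_dE hp) def_p raddf_sum mulr_suml.
apply: ideal_sum => // u /sX/variables_homog1 hu _ /=.
rewrite pihomogM1 // mulrAC mulrC; apply: idealM => //.
by apply: IHr; apply: pihomogP.
Qed.

End MinimalGenerators.
End LinearQuotients.

Theorem corollary2p4 (K : fieldType) (n m : nat)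
    (I : {mpoly K[n]} -> Prop) (f : 'I_m -> {mpoly K[n]})
    (I_homog : homogeneous_ideal I)
    (f_min : minimal_homogeneous_generators f I)
    (f_linquot : linear_quotients f I) :
  componentwise_linear I.
Proof.
have [dg f_homog] : exists dg, forall k, f k \is (dg k).-homog.
  have homogE k := homogP _ _ (f_min.1.1 k).
  by have [dg hdg] := fin_all_exists homogE; exists dg.
move=> j i d ne_d; exists (koszul_resolution K n) => v chain_v cyc_v.
(* Entries of the chain have degree [d - i], or vanish if [d < i]. Below [j] the chain is zero;
   above [j] the degree is [e.+1] with [j <= e]. *)
case: (ltngtP d (i + j)) ne_d => // [lt_d|gt_d] _.
  have -> : v = 0.
    apply/rowP => a; rewrite mxE; have [Mv] := chain_v a.
    rewrite /shifted_homog /=; case: leqP => [le_id hv|_ /eqP //].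
    by apply: (ideal_component_low_degree _ Mv hv); rewrite ltn_subLR.
  exists 0 => [a|]; last by rewrite mul0mx.
  rewrite mxE /shifted_homog dhomog0 eqxx if_same; split=> //.
  exact: ideal0 (ideal_gen_is_ideal _).
have [e le_je def_d] : exists2 e, (j <= e)%N & d = (i + e.+1)%N.
  have lt_jdi : (j < d - i)%N by rewrite ltn_subRL.
  exists (d - i).-1; first by rewrite -ltnS (ltn_predK lt_jdi).
  rewrite (ltn_predK lt_jdi) subnKC // ltnW // -subn_gt0.
  exact: leq_ltn_trans lt_jdi.
have hv a : v 0 a \is e.+1.-homog.
  by have [_] := chain_v a; rewrite /shifted_homog /= def_d leq_addr addKn.
(* With [t] equal to [m], all generators of degree at most [j] are present. The preimage has entries
   of degree [e >= j], so they return to [ideal_component j I]. *)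
have [k dg_k|a||w Mw ->] := @initial_ideal_acyclic _ _ _ f dg f_homog
    (fun k => dg k <= j)%N j (fun k => id) _ m _ _ v le_je hv.
- exact: degree_truncation_linear_quotients f_min f_linquot _ _ dg_k.
- exact: ideal_component_sub (chain_v a).1.
- exact: cyc_v.
exists w => // a; have [Jw hw] := Mw a; split.
  exact: ideal_component_high_degree hw Jw.
by rewrite /shifted_homog /= def_d addnS ltnS leq_addr subSS addKn.
Qed.
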